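(* Let $H$ be a Hilbert space, $A:H\rightrightarrows H$ a maximally monotone operator, $\beta>0$, $B:H\to H$ a $\beta$-cocoercive mapping, $\gamma\in(0,2\beta]$, and assume $\mathrm{zer}(A+B)\ne\emptyset$. Let $\alpha=\frac{2\beta}{4\beta-\gamma}\in\left(\frac12,1\right]$, let $x_0,u\in H$, let $(\beta_n)$ be a sequence in $[0,1]$ and $(\lambda_n)$ a sequence in $\left[0,\frac1\alpha\right]$, and let the Tikhonov-forward-backward algorithm be defined by $$x_{n+1}=(1-\lambda_n)u_n+\lambda_nJ_{\gamma A}(u_n-\gamma Bu_n),\qquad u_n=(1-\beta_n)u+\beta_nx_n.$$ Let $T=J_{\gamma A}(\mathrm{Id}-\gamma B):H\to H$. Then there exists a nonexpansive mapping $U:H\to H$ such that $T=(1-\alpha)\mathrm{Id}+\alpha U$, $Fix(U)=Fix(T)\neq\emptyset$, and for all $n\in\mathbb N$, $$x_{n+1}=(1-\alpha\lambda_n)u_n+\alpha\lambda_nUu_n.$$ That is, $(x_n)$ is the Tikhonov-Mann iteration associated with the nonexpansive mapping $U$, with parameters $(\beta_n)$ and $(\alpha\lambda_n)$.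
   Context: For a set-valued operator $A:H\rightrightarrows H$, $\mathrm{zer}A=\{x\in H\mid 0\in Ax\}$; $A$ is monotone if $\langle x-y,v-w\rangle\ge0$ for all $x,y\in H$, $v\in Ax$, $w\in Ay$; it is maximally monotone if it is monotone and its graph is not properly contained in the graph of another monotone operator. The resolvent is $J_A=(\mathrm{Id}+A)^{-1}$, a single-valued mapping $H\to H$ for maximally monotone $A$. A mapping $B:H\to H$ is $\beta$-cocoercive if $\langle x-y,Bx-By\rangle\ge\beta\|Bx-By\|^2$ for all $x,y\in H$. A mapping $U:H\to H$ is nonexpansive if $\|Ux-Uy\|\le\|x-y\|$ for all $x,y$; $Fix(U)$ is its set of fixed points. The constant $\beta$ is unrelated to the sequence $(\beta_n)$. The Tikhonov-Mann iteration (in a Hilbert space $H$) associated with a nonexpansive mapping $U:H\to H$ having a fixed point, points $x_0,u\in H$ and parameter sequences $(\beta_n),(\mu_n)$ in $[0,1]$ is $x_{n+1}=(1-\mu_n)u_n+\mu_nUu_n$ with $u_n=(1-\beta_n)u+\beta_nx_n$. *)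

(* Defs.v *)
From HB Require Import structures.
From mathcomp Require Import all_boot all_order all_algebra.
From mathcomp Require Import sesquilinear.
From mathcomp Require Import all_classical all_reals all_analysis.

Set Implicit Arguments.
Unset Strict Implicit.
Unset Printing Implicit Defensive.

Import Order.TTheory GRing.Theory Num.Theory.
Import numFieldNormedType.Exports.

Local Open Scope classical_set_scope.
Local Open Scope ring_scope.

(* A real Hilbert space is a complete normed module [H] over [R : realType]
   together with a positive definite symmetric bilinear form
   [ip : {dot H for idfun}] that induces the norm of [H]. *)
Definition induces_norm (R : realType) (H : completeNormedModType R)
    (ip : {dot H for idfun}) : Prop :=
  forall x : H, `|x| = Num.sqrt (ip x x).

Section SetValuedOperators.
Variables (R : realType) (H : completeNormedModType R).
Implicit Types (A C : H -> set H) (f : H -> H).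

Definition single f : H -> set H := fun x => [set f x].

Definition op_add A C : H -> set H :=
  fun x => [set v + w | v in A x & w in C x].

Definition op_scale (c : R) A : H -> set H := fun x => [set c *: v | v in A x].

Definition op_inv A : H -> set H := fun x => [set y | A y x].

Definition zer A : set H := [set x | A x 0].

Definition graph_of A : set (H * H) := [set p | A p.1 p.2].

(* [(Id + A)^-1] read as a function: for [A] maximally monotone the set
   [op_inv (op_add (single idfun) A) x] is a singleton for every [x] (Minty), and
   [resolvent A x] is its element. The value [0] is only used where that set is
   empty. *)
Definition resolvent A : H -> H :=
  fun x => xget 0 (op_inv (op_add (single idfun) A) x).

Definition nonexpansive f : Prop := forall x y, `|f x - f y| <= `|x - y|.

Definition fixpoints f : set H := [set x | f x = x].

Definition monotone (ip : {dot H for idfun}) A : Prop :=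
  forall x y v w, A x v -> A y w -> 0 <= ip (x - y) (v - w).

Definition maximally_monotone (ip : {dot H for idfun}) A : Prop :=
  monotone ip A /\
  ~ (exists C, monotone ip C /\ graph_of A `<` graph_of C).

Definition cocoercive (ip : {dot H for idfun}) (b : R) f : Prop :=
  forall x y, b * `|f x - f y| ^+ 2 <= ip (x - y) (f x - f y).

(* [x] is the Tikhonov-Mann iteration associated with [U], started at [x0], with
   anchor [u] and parameters [b], [m]. *)
Definition tikhonov_mann (U : H -> H) (x0 u : H) (b m : nat -> R)
    (x : nat -> H) : Prop :=
  [/\ nonexpansive U /\ fixpoints U !=set0,
      forall n, 0 <= b n <= 1,
      forall n, 0 <= m n <= 1,
      x 0%N = x0 &
      forall n, let un := (1 - b n) *: u + b n *: x n in
        x n.+1 = (1 - m n) *: un + m n *: U un].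

End SetValuedOperators.

(* Main.v *)
Require Import Defs.
From HB Require Import structures.
From mathcomp Require Import all_boot all_order all_algebra.
From mathcomp Require Import sesquilinear.
From mathcomp Require Import all_classical all_reals all_analysis.
From mathcomp Require Import ring lra.

Import Order.TTheory GRing.Theory Num.Theory.
Import numFieldNormedType.Exports.

Local Open Scope classical_set_scope.
Local Open Scope ring_scope.

(** The map [U] is forced to be [(1 - 1/alpha) Id + (1/alpha) T]; what has to be
    shown is that it is nonexpansive. Put [k = 1/alpha = 2 - gamma/(2 beta)] and,
    for two points, [p = x - y], [q = B x - B y], [t = T x - T y]. Firm
    nonexpansiveness of the resolvent gives [|t|^2 <= <t, p - gamma q>],
    cocoercivity gives [beta |q|^2 <= <p, q>], and
    [|p|^2 - |(1 - k) p + k t|^2] is bounded below by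
    [k (2 - k) |p - t - 2 beta q|^2] ([forward_backward_averaged]). The fixed
    points of [T] and [U] agree since [alpha <> 0], and a zero of [A + B] is a
    fixed point of [T].

    The substance is that [resolvent (op_scale gamma A)] really is the resolvent:
    its defining set must be nonempty at every point, which is Minty's theorem
    ([minty_scale]). By translation and scaling this reduces to finding [x] with
    [- x] in [A x] ([minty_zero]). Minimise over pairs [(x, s)] the supremum, over
    the graph points [(y, w)] of [A], of
    [2 <x, w> + 2 <y, s> - 2 <y, w> + |x|^2 + |s|^2]; this is twice the Fitzpatrick
    function of [A] plus the squared norm of the pair. Since each term equals
    [|x + w|^2 + |s + y|^2 - |y + w|^2], only squared distances occur, and the
    parallelogram law makes minimising sequences Cauchy
    ([sup_sqr_dist_minimizer]). If [(x0, s0)] is the minimiser, the quadratic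
    growth around it makes [(- s0, - x0)] monotonically related to [A], so this
    pair lies in the graph; used once more at that very pair, the growth
    inequality forces [s0 = - x0]. *)

(** * Squared norms in a Hilbert space *)

Section InnerProduct.
Context {R : realType} {H : completeNormedModType R} (ip : {dot H for idfun}).
Implicit Types x y z a : H.

Lemma ipC x y : ip x y = ip y x.
Proof. by rewrite (hermC (theta := idfun) ip x y) expr0 mul1r. Qed.

Lemma ipDl x y z : ip (x + y) z = ip x z + ip y z.
Proof. exact: linearDl. Qed.
Lemma ipDr x y z : ip x (y + z) = ip x y + ip x z.
Proof. by rewrite ipC ipDl !(ipC x). Qed.
Lemma ipNl x y : ip (- x) y = - ip x y.
Proof. exact: linearNl. Qed.
Lemma ipNr x y : ip x (- y) = - ip x y.
Proof. by rewrite ipC ipNl ipC. Qed.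
Lemma ipZl (c : R) x y : ip (c *: x) y = c * ip x y.
Proof. exact: linearZl_LR. Qed.
Lemma ipZr (c : R) x y : ip x (c *: y) = c * ip x y.
Proof. by rewrite ipC ipZl ipC. Qed.

Definition ipE := (ipDl, ipDr, ipNl, ipNr, ipZl, ipZr).

Hypothesis ip_norm : induces_norm ip.

Lemma sqr_normE x : `|x| ^+ 2 = ip x x.
Proof.
rewrite ip_norm sqr_sqrtr //; have [->|x0] := eqVneq x 0.
  by rewrite linear0l.
exact/ltW/neq0_dnorm_gt0.
Qed.

(** The parallelogram law in weighted form: squared distances are uniformly
    convex, with the same modulus for every centre [a]. *)
Lemma sqr_dist_cvx (t : R) x y a :
  `|(1 - t) *: x + t *: y - a| ^+ 2 =
  (1 - t) * `|x - a| ^+ 2 + t * `|y - a| ^+ 2 - t * (1 - t) * `|x - y| ^+ 2.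
Proof. by rewrite !sqr_normE !ipE (ipC y x) (ipC a x) (ipC a y); ring. Qed.

End InnerProduct.

Lemma cvg_of_sqr_dist {R : realType} {H : completeNormedModType R}
    {u : nat -> H} {e : nat -> R} : e @ \oo --> 0 ->
  (forall n p, `|u n - u p| ^+ 2 <= e n + e p) -> cvg (u @ \oo).
Proof.
move=> e0 ue; apply/cauchy_cvgP/cauchy_ballP => d d0; near_simpl.
have d2 : 0 < d ^+ 2 / 2 by rewrite divr_gt0// exprn_gt0.
near=> n p; rewrite -ball_normE /= -(ltr_pXn2r (n := 2)) ?nnegrE ?(ltW d0)//.
apply: (le_lt_trans (ue n p)); rewrite [ltRHS]splitr ltrD //.
  by near: n; exact: (cvgr_lt _ e0).
by near: p; exact: (cvgr_lt _ e0).
Unshelve. all: by end_near. Qed.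

(** * Minimising a supremum of squared distances *)

Section SupSqrDist.
Context {R : realType} {H : completeNormedModType R} {ip : {dot H for idfun}}.
Hypothesis ip_norm : induces_norm ip.

(** [P] lists pairs of centres [(a, b)] with an offset [r]. Bounding the supremum
    by [c] is stated pointwise, since the supremum itself may be infinite. *)
Definition sup_sqr_dist_le (P : H -> H -> R -> Prop) (c : R) (x s : H) :=
  forall a b r, P a b r -> `|x - a| ^+ 2 + `|s - b| ^+ 2 - r <= c.

(** The modulus in [sqr_dist_cvx] does not depend on the centre, so it survives
    the supremum. *)
Lemma sup_sqr_dist_cvx {P c d x y s z} (t : R) : 0 <= t <= 1 ->
  sup_sqr_dist_le P c x s -> sup_sqr_dist_le P d y z ->
  sup_sqr_dist_le P ((1 - t) * c + t * d
      - t * (1 - t) * (`|x - y| ^+ 2 + `|s - z| ^+ 2))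
    ((1 - t) *: x + t *: y) ((1 - t) *: s + t *: z).
Proof.
move=> /andP[t0 t1] xs yz a b r Pabr; rewrite !(sqr_dist_cvx _ ip_norm).
have := ler_wpM2l t0 (yz _ _ _ Pabr).
have t1' : 0 <= 1 - t by lra.
have := ler_wpM2l t1' (xs _ _ _ Pabr).
lra.
Qed.

(** Uniform convexity at midpoints makes minimising sequences Cauchy, and
    sublevel sets are closed; uniform convexity on segments issued from the
    minimiser then gives the quadratic growth. *)
Lemma sup_sqr_dist_minimizer (P : H -> H -> R -> Prop) :
    (exists a b r, P a b r) -> (exists c x s, sup_sqr_dist_le P c x s) ->
  exists m x0 s0, sup_sqr_dist_le P m x0 s0 /\
    forall c x s, sup_sqr_dist_le P c x s ->
      m + `|x - x0| ^+ 2 + `|s - s0| ^+ 2 <= c.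
Proof.
move=> [a [b [r Pabr]]] [c0 [x0 [s0 c0P]]].
pose levels := [set c | exists x s, sup_sqr_dist_le P c x s].
have lbl : has_lbound levels.
  exists (- r) => c [x [s /(_ _ _ _ Pabr)]].
  by have := sqr_ge0 `|x - a|; have := sqr_ge0 `|s - b|; lra.
have infl : has_inf levels by split => //; exists c0, x0, s0.
pose m := inf levels; pose e n : R := n.+1%:R^-1.
have m_le c x s : sup_sqr_dist_le P c x s -> m <= c.
  by move=> cxs; apply: ge_inf => //; exists x, s.
have e_gt0 n : 0 < e n by rewrite invr_gt0.
have /choice[p pP] n : exists p, sup_sqr_dist_le P (m + e n) p.1 p.2.
  have [c [x [s cP]] clt] := inf_adherent (e_gt0 n) infl.
  by exists (x, s) => a' b' r' /cP /le_trans; apply; exact: ltW.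
have e0 : e @ \oo --> 0 by exact: cvg_harmonic.
have e20 : (fun n => 2 * e n) @ \oo --> 0.
  by rewrite -(mulr0 (2 : R)); apply: cvgM => //; exact: cvg_cst.
have pdist n k : `|(p n).1 - (p k).1| ^+ 2 + `|(p n).2 - (p k).2| ^+ 2
    <= 2 * e n + 2 * e k.
  (* The midpoint of two points of levels m + e n and m + e k has level at least
     m, which bounds a quarter of the squared distance by (e n + e k) / 2. *)
  have h : 0 <= (2^-1 : R) <= 1 by lra.
  by have /m_le := sup_sqr_dist_cvx _ h (pP n) (pP k); lra.
have cvg1 : cvg ((fst \o p) @ \oo).
  apply: (cvg_of_sqr_dist e20) => n k; apply: le_trans (pdist n k).
  by rewrite lerDl sqr_ge0.
have cvg2 : cvg ((snd \o p) @ \oo).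
  apply: (cvg_of_sqr_dist e20) => n k; apply: le_trans (pdist n k).
  by rewrite lerDr sqr_ge0.
pose xl := lim ((fst \o p) @ \oo); pose sl := lim ((snd \o p) @ \oo).
have cvg_sqr_dist (u : nat -> H) l z :
    u @ \oo --> l -> (fun n => `|u n - z| ^+ 2) @ \oo --> `|l - z| ^+ 2.
  move=> ul; have nl : (fun n => `|u n - z|) @ \oo --> `|l - z|.
    by apply: cvg_norm; apply: cvgB => //; exact: cvg_cst.
  by rewrite expr2; under eq_fun do rewrite expr2; exact: cvgM.
have lP : sup_sqr_dist_le P m xl sl.
  move=> a' b' r' P'.
  have lhs : (fun n => `|(p n).1 - a'| ^+ 2 + `|(p n).2 - b'| ^+ 2 - r') @ \oo
      --> `|xl - a'| ^+ 2 + `|sl - b'| ^+ 2 - r'.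
    by apply: cvgB; [apply: cvgD; exact: cvg_sqr_dist|exact: cvg_cst].
  have rhs : (fun n => m + e n) @ \oo --> m.
    by rewrite -[X in _ --> X]addr0; apply: cvgD => //; exact: cvg_cst.
  by apply: (ler_cvg_to lhs rhs); near=> n; exact: pP.
exists m, xl, sl; split => // c x s cP.
set D := `|x - xl| ^+ 2 + `|s - sl| ^+ 2.
have D0 : 0 <= D by rewrite addr_ge0 ?sqr_ge0.
(* Going a fraction t from the minimiser towards (x, s) and dividing by t gives
   m + (1 - t) * D <= c; this t makes t * D at most d. *)
rewrite -addrA -/D; apply/ler_addgt0Pr => d d0.
pose t := d / (D + d).
have t01 : 0 <= t <= 1.
  by rewrite divr_ge0 ?ler_pdivrMr /=; lra.
have t0 : 0 < t by rewrite divr_gt0; lra.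
have tD : t * D <= d.
  rewrite /t mulrAC ler_pdivrMr; [|lra].
  by rewrite ler_pM2l// lerDl ltW.
have /m_le := sup_sqr_dist_cvx _ t01 lP cP.
rewrite (distrC xl) (distrC sl) -/D => mle.
have : 0 <= t * (c - m - (1 - t) * D) by lra.
by rewrite pmulr_rge0//; lra.
Unshelve. all: by end_near. Qed.
End SupSqrDist.

(** * Minty's theorem and resolvents *)

Section Minty.
Context {R : realType} {H : completeNormedModType R} {ip : {dot H for idfun}}.
Hypothesis ip_norm : induces_norm ip.
Implicit Types A : H -> set H.

Definition monotonically_related (ip : {dot H for idfun}) A (x v : H) :=
  forall y w, A y w -> 0 <= ip (x - y) (v - w).

(** Otherwise adding [(x, v)] to the graph would give a proper monotone
    extension. *)
Lemma maximally_monotone_mem {A} : maximally_monotone ip A ->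
  forall x v, monotonically_related ip A x v -> A x v.
Proof.
move=> [Amono Amax] x v xv; apply: contrapT => nAxv; apply: Amax.
exists (fun y => [set w | A y w \/ (y = x /\ w = v)]); split.
  move=> y z w1 w2 /= [Ayw|[-> ->]] [Azw|[-> ->]]; first exact: Amono.
  - by rewrite -(opprB x) -(opprB v) ipNl ipNr opprK; exact: xv.
  - exact: xv.
  - by rewrite !subrr linear0l.
split=> [[y w] /= Ayw|sub]; first by left.
by apply: nAxv; apply: (sub (x, v)); right.
Qed.

(** The supremum is taken over the centres [(- w, - y)] with [(y, w)] in the graph.
    At a graph point [(x, s)] it is at most [|x + s|^2] by monotonicity, and at
    every point [(x, s)] it is at least [|x + s|^2] by maximality; the minimiser
    is thus squeezed by the growth inequality. *)
Lemma minty_zero {A} : Defs.monotone ip A ->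
  (forall x v, monotonically_related ip A x v -> A x v) ->
  exists x, A x (- x).
Proof.
move=> Amono Amax.
have [y0 [w0 A0]] : exists y w, A y w.
  (* Anything is monotonically related to an empty graph. *)
  apply: contrapT => A0; apply: (A0); exists 0, 0; apply: Amax => y w Ayw.
  by exfalso; apply: A0; exists y, w.
pose P a b r := exists y w, [/\ A y w, a = - w, b = - y & r = `|y + w| ^+ 2].
have graphP x s : A x s -> sup_sqr_dist_le P (`|x + s| ^+ 2) x s.
  move=> Axs _ _ _ [y [w [Ayw -> -> ->]]].
  have := Amono _ _ _ _ Axs Ayw; rewrite !(sqr_normE ip ip_norm) !ipE.
  by rewrite (ipC ip s x) (ipC ip w x) (ipC ip w y) (ipC ip s y); lra.
have sqr_le_sup c x s : sup_sqr_dist_le P c x s -> `|x + s| ^+ 2 <= c.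
  move=> cP; have rel y w : A y w ->
      `|x + s| ^+ 2 - c <= 2 * ip (x - y) (s - w).
    move=> Ayw; have Pyw : P (- w) (- y) (`|y + w| ^+ 2) by exists y, w.
    have := cP _ _ _ Pyw.
    rewrite !(sqr_normE ip ip_norm) !ipE.
    by rewrite (ipC ip s x) (ipC ip w x) (ipC ip w y) (ipC ip s y); lra.
  rewrite leNgt; apply/negP => clt.
  have /rel : A x s by apply: Amax => y w /rel; lra.
  by rewrite subrr linear0l; lra.
have [||m [x0 [s0 [/sqr_le_sup mge mP]]]] := sup_sqr_dist_minimizer ip_norm P.
- by exists (- w0), (- y0), (`|y0 + w0| ^+ 2), y0, w0.
- by exists (`|y0 + w0| ^+ 2), y0, w0; exact: graphP.
have key x s : A x s ->
    `|x0 + s0| ^+ 2 + `|x - x0| ^+ 2 + `|s - s0| ^+ 2 <= `|x + s| ^+ 2.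
  by move=> /graphP /mP; lra.
have A1 : A (- s0) (- x0).
  apply: Amax => y w /key; have := sqr_ge0 `|x0 + s0|.
  rewrite !(sqr_normE ip ip_norm) !ipE.
  rewrite (ipC ip s0 x0) (ipC ip w y) (ipC ip y x0) (ipC ip w s0); lra.
have := key _ _ A1.
have -> : `|- s0 - x0| = `|x0 + s0| by rewrite -opprD normrN addrC.
have -> : `|- x0 - s0| = `|x0 + s0| by rewrite -opprD normrN.
have := sqr_ge0 `|x0 + s0| => h1 h2.
have /eqP : `|x0 + s0| ^+ 2 = 0 by lra.
rewrite sqrf_eq0 normr_eq0 addr_eq0 => /eqP x0E.
by exists x0; rewrite -x0E in A1.
Qed.

(** [- x] lies in the image of [x] under [v |-> c v - z] applied to [A] exactly
    when [z] lies in [x + c A x]; that shifted and scaled operator is again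
    monotone and maximal. *)
Lemma minty_scale {A} {c : R} : maximally_monotone ip A -> 0 < c ->
  forall z, exists x v, A x v /\ x + c *: v = z.
Proof.
move=> Amax c0 z; have c_neq0 : c != 0 by rewrite gt_eqF.
pose A' x := [set v | A x (c^-1 *: (v + z))].
have scaleE x y v w : ip (x - y) (v - w)
    = c * ip (x - y) (c^-1 *: (v + z) - c^-1 *: (w + z)).
  by rewrite -scalerBr -ipZr scalerA divff// scale1r opprD addrACA subrr addr0.
have [| |x Ax] := @minty_zero A'.
- move=> x y v w A'v A'w; rewrite scaleE mulr_ge0 ?(ltW c0)//.
  exact: (proj1 Amax).
- move=> x v xv; apply: (maximally_monotone_mem Amax) => y w Ayw.
  have wE : c^-1 *: (c *: w - z + z) = w.
    by rewrite subrK scalerA mulVf// scale1r.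
  have := xv y (c *: w - z); rewrite scaleE wE pmulr_rge0//; apply.
  by rewrite /A' /= wE.
- exists x, (c^-1 *: (- x + z)); split=> //.
  by rewrite scalerA divff// scale1r addrC addrAC addNr add0r.
Qed.

(** Monotonicity read in terms of [Id + c A]; it yields both the uniqueness of
    resolvent values and their firm nonexpansiveness. *)
Lemma sqr_dist_graph {A} {c : R} {x y v w} : Defs.monotone ip A -> 0 < c ->
  A x v -> A y w ->
  `|x - y| ^+ 2 <= ip (x - y) ((x + c *: v) - (y + c *: w)).
Proof.
move=> Amono c0 Axv Ayw; rewrite opprD addrACA -scalerBr ipDr ipZr.
by rewrite (sqr_normE ip ip_norm) lerDl mulr_ge0 ?(ltW c0)//; exact: Amono.
Qed.

Lemma resolvent_scaleP {A} {c : R} : maximally_monotone ip A -> 0 < c ->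
  forall z, exists v, A (resolvent (op_scale c A) z) v /\
    resolvent (op_scale c A) z + c *: v = z.
Proof.
move=> Amax c0 z; have [x [v [Axv xvz]]] := minty_scale Amax c0 z.
have : op_inv (op_add (single idfun) (op_scale c A)) z
         (resolvent (op_scale c A) z).
  apply: xgetPex; exists x; exists x => //; exists (c *: v) => //.
  by exists v.
by move=> [_ -> [_ [w Aw <-] wE]]; exists w.
Qed.

Lemma resolvent_scaleE {A} {c : R} {x v} : maximally_monotone ip A -> 0 < c ->
  A x v -> resolvent (op_scale c A) (x + c *: v) = x.
Proof.
move=> Amax c0 Axv; have [w [Aw wE]] := resolvent_scaleP Amax c0 (x + c *: v).
have := sqr_dist_graph (proj1 Amax) c0 Aw Axv.
rewrite wE subrr linear0r => le0; apply/eqP; rewrite -subr_eq0 -normr_eq0.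
by rewrite -sqrf_eq0 eq_le le0 sqr_ge0.
Qed.

Lemma resolvent_firmly_nonexpansive {A} {c : R} :
  maximally_monotone ip A -> 0 < c ->
  let J := resolvent (op_scale c A) in
  forall x y, `|J x - J y| ^+ 2 <= ip (J x - J y) (x - y).
Proof.
move=> Amax c0 J x y.
have [v [Av vE]] := resolvent_scaleP Amax c0 x.
have [w [Aw wE]] := resolvent_scaleP Amax c0 y.
by have := sqr_dist_graph (proj1 Amax) c0 Av Aw; rewrite vE wE.
Qed.

(** * The forward-backward operator *)

(** With [d = 2 - k = c / (2 b)], add twice the firm nonexpansiveness inequality,
    [2 c] times cocoercivity and [d |p - t - 2 b q|^2 >= 0]: all terms in [q]
    cancel because [c = 2 b d]. *)
Lemma forward_backward_averaged {b c : R} {B J : H -> H} :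
  0 < b -> 0 < c -> c <= 2 * b -> cocoercive ip b B ->
  (forall x y, `|J x - J y| ^+ 2 <= ip (J x - J y) (x - y)) ->
  let T x := J (x - c *: B x) in let k := (4 * b - c) / (2 * b) in
  nonexpansive (fun x => (1 - k) *: x + k *: T x).
Proof.
move=> b0 c0 c_le Bcoco Jfne T k x y.
have k0 : 0 <= k by rewrite divr_ge0//; lra.
rewrite -(ler_pXn2r (n := 2)) ?nnegrE//.
have := Jfne (x - c *: B x) (y - c *: B y); rewrite -/(T x) -/(T y) => Jxy.
have := Bcoco x y => Bxy.
pose p := x - y; pose q := B x - B y; pose t := T x - T y.
have -> : (1 - k) *: x + k *: T x - ((1 - k) *: y + k *: T y)
    = (1 - k) *: p + k *: t.
  by rewrite opprD addrACA -!scalerBr.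
have JE : x - c *: B x - (y - c *: B y) = p - c *: q.
  by rewrite opprD addrACA -opprD -scalerBr.
rewrite JE -/t in Jxy; rewrite -/p -/q in Bxy *.
have cE : c = (2 - k) * (2 * b) by rewrite /k; field; lra.
have d0 : 0 < 2 - k by rewrite -(pmulr_lgt0 _ (x := 2 * b)) -?cE//; lra.
have := mulr_ge0 (ltW d0) (sqr_ge0 `|p - t - (2 * b) *: q|).
have := ler_wpM2l (ltW c0) Bxy; move: Jxy.
clearbody p q t k.
rewrite !(sqr_normE ip ip_norm) !ipE.
rewrite (ipC ip t p) (ipC ip t q) (ipC ip q p) cE => h1 h2 h3.
have key : 0 <= (2 - k) * ip p p - k * ip t t - 2 * (1 - k) * ip p t.
  lra.
have := mulr_ge0 k0 key; lra.
Qed.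


End Minty.

Theorem mainTheorem5 (R : realType) (H : completeNormedModType R)
    (ip : {dot H for idfun}) (ip_norm : induces_norm ip)
    (A : H -> set H) (A_max : maximally_monotone ip A)
    (beta : R) (beta_gt0 : 0 < beta)
    (B : H -> H) (B_coco : cocoercive ip beta B)
    (gamma : R) (gamma_gt0 : 0 < gamma) (gamma_le : gamma <= 2 * beta)
    (zerAB : zer (op_add A (single B)) !=set0)
    (alpha : R) (alphaE : alpha = 2 * beta / (4 * beta - gamma))
    (x0 u : H)
    (beta_ : nat -> R) (beta_01 : forall n, 0 <= beta_ n <= 1)
    (lambda_ : nat -> R) (lambda_0V : forall n, 0 <= lambda_ n <= 1 / alpha)
    (x_ u_ : nat -> H)
    (x_0 : x_ 0%N = x0)
    (u_E : forall n, u_ n = (1 - beta_ n) *: u + beta_ n *: x_ n)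
    (x_S : forall n, x_ n.+1 = (1 - lambda_ n) *: u_ n
       + lambda_ n *: resolvent (op_scale gamma A) (u_ n - gamma *: B (u_ n)))
    (T : H -> H)
    (TE : forall x, T x = resolvent (op_scale gamma A) (x - gamma *: B x)) :
  1 / 2 < alpha <= 1 /\
  exists U : H -> H,
    [/\ nonexpansive U,
        forall x, T x = (1 - alpha) *: x + alpha *: U x,
        fixpoints U = fixpoints T /\ fixpoints T !=set0,
        forall n, x_ n.+1 = (1 - alpha * lambda_ n) *: u_ n
                            + (alpha * lambda_ n) *: U (u_ n) &
        tikhonov_mann U x0 u beta_ (fun n => alpha * lambda_ n) x_].

Proof.
have den0 : 0 < 4 * beta - gamma by lra.
have a0 : 0 < alpha by rewrite alphaE divr_gt0//; lra.
have aV : (4 * beta - gamma) / (2 * beta) = alpha^-1 by rewrite alphaE invf_div.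
have J_fne := resolvent_firmly_nonexpansive ip_norm A_max gamma_gt0.
split.
  by rewrite alphaE ltr_pdivlMr// ler_pdivrMr//; lra.
pose U x := (1 - alpha^-1) *: x + alpha^-1 *: T x.
have U_nonexp : nonexpansive U.
  have := forward_backward_averaged ip_norm beta_gt0 gamma_gt0 gamma_le B_coco J_fne.
  by rewrite /= aV => + x y => /(_ x y); rewrite /U !TE.
have TU x : T x = (1 - alpha) *: x + alpha *: U x.
  rewrite /U scalerDr !scalerA mulfV ?gt_eqF// scale1r addrA -scalerDl.
  by rewrite mulrBr mulr1 mulfV ?gt_eqF// addrA subrK subrr scale0r add0r.
have fixUT : fixpoints U = fixpoints T.
  apply/seteqP; split=> x; rewrite /fixpoints /= => fx.
    by rewrite TU fx -scalerDl subrK scale1r.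
  by rewrite /U fx -scalerDl subrK scale1r.
have fixT : fixpoints T !=set0.
  have [z [v Azv [_ -> vB]]] := zerAB.
  exists z; rewrite /fixpoints /= TE.
  have -> : z - gamma *: B z = z + gamma *: v.
    by rewrite -scalerN; congr (_ + _ *: _); apply/esym/eqP; rewrite -addr_eq0 vB.
  exact: resolvent_scaleE.
have x_mann n :
    x_ n.+1 = (1 - alpha * lambda_ n) *: u_ n + (alpha * lambda_ n) *: U (u_ n).
  rewrite x_S -TE TU scalerDr addrA !scalerA -scalerDl.
  by congr (_ *: _ + _ *: _); ring.
exists U; split=> //; split=> //; first by split=> //; rewrite fixUT.
  move=> n; have /andP[l0 l1] := lambda_0V n; rewrite mulr_ge0 ?(ltW a0)//=.
  by move: l1; rewrite ler_pdivlMr// mulrC.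
by move=> n un; rewrite /un -u_E.
Qed.
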